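(* A metrizable topological abelian group $X$ belongs to the class $\mathfrak B$ if and only if $X$ is locally generated. In particular, $\mathfrak B$ contains all connected metrizable abelian groups.
   Context: $\mathbb S=\{s\in\mathbb C:|s|=1\}$. For a topological abelian group $X$, $X^\wedge$ is the group of all continuous homomorphisms $X\to\mathbb S$, with neutral element $1$ (the constant character), and $c_0(X)$ is the group of all sequences in $X$ converging to the neutral element. $\Gamma_{\mathrm{abs}}(X)$ is the set of $\xi\in X^\wedge$ such that for every $(x_n)\in c_0(X)$ the sequence of partial products $\left(\prod_{k=1}^n\xi(x_k)\right)_{n\in\mathbb N}$ converges in $\mathbb S$. $\mathfrak B$ is the class of topological abelian groups $X$ with $\Gamma_{\mathrm{abs}}(X)=\{1\}$. A topological group $X$ is locally generated if every neighborhood $V$ of the neutral element generates $X$ as a group, i.e. $\langle V\rangle=X$. *)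

(* Defs.v *)
From HB Require Import structures.
From mathcomp Require Import all_boot all_order all_algebra.
From mathcomp Require Import all_classical all_reals all_analysis.
From mathcomp Require Import complex.

Set Implicit Arguments.
Unset Strict Implicit.
Unset Printing Implicit Defensive.

Import Order.TTheory GRing.Theory Num.Theory.
Import numFieldNormedType.Exports.

Local Open Scope classical_set_scope.
Local Open Scope ring_scope.
Local Open Scope complex_scope.

(* R[i]^o carries the topology of the modulus. The circle has the subspace
   topology: continuity of an S-valued map is continuity into R[i]^o, and
   convergence in S is convergence in R[i]^o to a point of S. *)
Definition circle (R : realType) : set (R[i]^o) := [set s | `|s| = 1].
Arguments circle R : clear implicits.

Definition character_group (R : realType) (X : topologicalZmodType) : set (X -> R[i]^o) :=
  [set xi | [/\ forall x, circle R (xi x),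
                {morph xi : x y / x + y >-> x * y} &
                continuous xi]].
Arguments character_group R X : clear implicits.

Definition c0 (X : topologicalZmodType) : set (nat -> X) :=
  [set x | x n @[n --> \oo] --> (0 : X)].
Arguments c0 X : clear implicits.

(* Sequences are indexed from 0: the n-th partial product has n + 1 factors. *)
Definition Gamma_abs (R : realType) (X : topologicalZmodType) :
    set (X -> R[i]^o) :=
  [set xi | character_group R X xi /\
     forall x : nat -> X, c0 X x ->
       exists2 l : R[i]^o, circle R l &
         \prod_(k < n.+1) xi (x k) @[n --> \oo] --> l].
Arguments Gamma_abs R X : clear implicits.

Definition class_B (R : realType) (X : topologicalZmodType) : Prop :=
  Gamma_abs R X = [set cst 1].

Definition generated_subgroup (X : zmodType) (V : set X) : set X :=
  smallest [set H : set X | zmod_closed (mem H)] V.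

Definition locally_generated (X : topologicalZmodType) : Prop :=
  forall V : set X, nbhs (0 : X) V -> generated_subgroup V = [set: X].

Definition is_metric (R : realType) (T : Type) (d : T -> T -> R) : Prop :=
  [/\ forall x y, 0 <= d x y,
      forall x y, d x y = 0 <-> x = y,
      forall x y, d x y = d y x &
      forall x y z, d x z <= d x y + d y z].

Definition metrizable (R : realType) (X : topologicalType) : Prop :=
  exists d : X -> X -> R, is_metric d /\
    forall x, nbhs x = filter_from [set e : R | 0 < e]
                                   (fun e => [set y | d x y < e]).

(* Main.v *)
(* If some neighborhood V of 0 generates a proper subgroup H, then H is open;
   as the circle is divisible, some nontrivial character of X is trivial on H.
   It is continuous, and on a null sequence its factors are eventually 1, so
   its partial products converge: X is not in the class B.
   Conversely, let X be locally generated, (U_k) a countable base at 0 and xi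
   in Gamma_abs.  Write a given a in X, for every k, as a finite sum of elements
   of U_k; concatenating these finite sequences gives a null sequence whose
   partial products pass through all the powers of xi(a).  If (xi(a)^n)
   converges to l on the circle, then xi(a) l = l, hence xi(a) = 1.
   A connected group has no proper open subgroup. *)
Require Import Defs.
From mathcomp Require Import all_boot all_order all_algebra.
From mathcomp Require Import all_classical all_reals all_analysis.
From mathcomp Require Import complex.

Set Implicit Arguments.
Unset Strict Implicit.
Unset Printing Implicit Defensive.

Import Order.TTheory GRing.Theory Num.Theory.
Import numFieldNormedType.Exports.

Local Open Scope classical_set_scope.
Local Open Scope ring_scope.

(** * Subgroups of the integers *)

Lemma zmod_closedP (X : zmodType) (H : set X) :
  zmod_closed (mem H) <-> H 0 /\ (forall x y, H x -> H y -> H (x - y)).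
Proof.
split=> [[H0 HB]|[H0 HB]]; split.
- by move: H0; rewrite inE.
- move=> x y Hx Hy.
  by have := HB x y; rewrite !in_setE => /(_ Hx Hy).
- by rewrite inE.
- by move=> x y; rewrite !in_setE; exact: HB.
Qed.

(** The least positive element of [I] generates it, since remainders modulo it stay in [I]; without
    a positive element [I] is trivial and [n = 0]. *)
Lemma int_subgroup_principal (I : set int) : zmod_closed (mem I) ->
  exists n : nat, forall m, I m <-> (n %| m)%Z.
Proof.
move=> /zmod_closedP[I0 IB].
have IN x : I x -> I (- x) by move=> Ix; rewrite -sub0r; exact: IB.
have ID x y : I x -> I y -> I (x + y).
  by move=> Ix Iy; rewrite -[y]opprK; apply/IB => //; exact: IN.
have IM x m : I x -> I (m * x).
  move=> Ix; have In (n : nat) : I (n%:Z * x).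
    elim: n => [|n IHn]; first by rewrite mul0r.
    by rewrite intS mulrDl mul1r; exact: ID.
  by case: (intP m) => [|n|n]; rewrite ?mul0r // mulNr; exact: IN.
have [[n [n_gt0 In]]|noI] := pselect (exists n : nat, (0 < n)%N /\ I n).
  have exI : exists n, (0 < n)%N && `[<I n%:Z>].
    by exists n; rewrite n_gt0; apply/asboolP.
  case: (ex_minnP exI) => {n n_gt0 In exI} n /andP[n_gt0 /asboolP In] n_min.
  exists n => m; split=> [Im|/dvdzP[q ->]]; last exact: IM.
  have n0 : (n : int) != 0 by rewrite gt_eqF.
  have Ir : I (m %% n)%Z by apply: IB => //; exact: IM.
  apply/dvdz_mod0P/eqP; apply: contraT => r0.
  have [r rE] : exists r : nat, (m %% n)%Z = r.
    by exists `|(m %% n)%Z|%N; rewrite gez0_abs ?modz_ge0.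
  have /n_min : (0 < r)%N && `[<I r%:Z>].
    by rewrite lt0n -(eqr_nat int) natz -rE r0; apply/asboolP.
  by rewrite leqNgt -ltz_nat -rE ltz_pmod ?ltz_nat.
exists 0%N => m; rewrite dvd0z; split=> [Im|/eqP-> //].
apply: contrapT => /negP m0; apply: noI; exists `|m|%N.
by rewrite absz_gt0; split=> //; case: (intP m) Im => // k /IN; rewrite opprK.
Qed.

(** * Extension of circle-valued characters of abstract abelian groups *)

Section CharacterExtension.
Variables (C : numClosedFieldType) (X : zmodType).
Implicit Types (G : set (X * C)) (H : set X) (p q : X * C).

(* Graph of a circle-valued character of a subgroup of [X]; for a subgroup of
   the product, the condition on [(0, z)] says that it is single-valued. *)
Definition character_graph G : Prop :=
  [/\ G (0, 1),
      forall p q, G p -> G q -> G (p.1 - q.1, p.2 / q.2),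
      forall z, G (0, z) -> z = 1 &
      forall p, G p -> `|p.2| = 1].

(** For a subgroup [G] of the product, this is the subgroup generated by [G] and [(b, t)]. *)
Definition adjoin G (b : X) (t : C) : set (X * C) :=
  [set p | exists q (m : int), G q /\ p = (q.1 + b *~ m, q.2 * t ^ m)].

Lemma character_graph_fun G x z z' :
  character_graph G -> G (x, z) -> G (x, z') -> z = z'.
Proof.
move=> [_ GB G1 Gn] Gz Gz'.
have z'0 : z' != 0 by rewrite -normr_gt0 (Gn _ Gz').
have := GB _ _ Gz Gz'; rewrite /= subrr => /G1 /(congr1 ( *%R^~ z')).
by rewrite divfK // mul1r.
Qed.

Lemma character_graphM G p q : character_graph G ->
  G p -> G q -> G (p.1 + q.1, p.2 * q.2).
Proof.
move=> [G0 GB _ _] Gp Gq; have := GB _ _ Gp (GB _ _ G0 Gq).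
by rewrite /= sub0r opprK div1r invrK.
Qed.

Lemma character_graphX G p (m : int) : character_graph G ->
  G p -> G (p.1 *~ m, p.2 ^ m).
Proof.
move=> GG Gp; have [G0 GB _ _] := GG.
have Gn n : G (p.1 *+ n, p.2 ^+ n).
  elim: n => [|n IHn]; first by rewrite mulr0n expr0.
  by rewrite mulrS exprS; exact: (character_graphM GG Gp IHn).
case: (intP m) => [|n|n]; first exact: (Gn 0%N).
  exact: Gn.
have := GB _ _ G0 (Gn n.+1).
by rewrite /= sub0r div1r mulrNz exprnN.
Qed.

Lemma sub_adjoin G b t : G `<=` adjoin G b t.
Proof. by move=> [x z] Gp; exists (x, z), 0; rewrite mulr0z expr0z addr0 mulr1. Qed.

Lemma adjoin_mem G b t : character_graph G -> adjoin G b t (b, t).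
Proof. by case=> G0 _ _ _; exists (0, 1), 1; rewrite mulr1z expr1z add0r mul1r. Qed.

(** The last hypothesis keeps the graph single-valued: if [p.1 + b *~ m = 0], it forces [p.2] to be
    the inverse of [t ^ m]. *)
Lemma character_graph_adjoin G b t : character_graph G -> `|t| = 1 ->
  (forall (m : int) z, G (b *~ m, z) -> z = t ^ m) ->
  character_graph (adjoin G b t).
Proof.
move=> GG t1 Gbt; have [G0 GB G1 Gn] := GG.
have t0 : t != 0 by rewrite -normr_gt0 t1.
split.
- exact: sub_adjoin.
- move=> _ _ [p [m [Gp ->]]] [q [n [Gq ->]]] /=.
  exists (p.1 - q.1, p.2 / q.2), (m - n); split; first exact: GB.
  congr pair => /=; first by rewrite mulrzBr opprD addrACA.
  by rewrite expfzDr // invfM mulrACA -invr_expz.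
- move=> z [p [m [Gp [/esym/eqP]]]].
  rewrite addr_eq0 => /eqP pE ->.
  have := character_graphX (-1) GG Gp.
  rewrite /= pE mulrN1z opprK => /Gbt <-.
  by rewrite exprN1 divff // -normr_gt0 Gn.
- move=> _ [p [m [Gp ->]]] /=.
  rewrite normrM Gn // mul1r.
  by case: m => m; rewrite /exprz ?normfV normrX t1 expr1n ?invr1.
Qed.

Lemma norm1_of_expr (t : C) n : (0 < n)%N -> `|t ^+ n| = 1 -> `|t| = 1.
Proof. by move=> n0; rewrite normrX => /eqP; rewrite pexpr_eq1 // => /eqP. Qed.

Lemma domain_period G b : character_graph G ->
  exists n : nat, forall m : int, (exists z, G (b *~ m, z)) <-> (n %| m)%Z.
Proof.
move=> [G0 GB _ _]; apply: (@int_subgroup_principal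
  [set m | exists z, G (b *~ m, z)]); apply/zmod_closedP; split.
  by exists 1; rewrite mulr0z.
move=> m n [z Gz] [w Gw]; exists (z / w).
by have := GB _ _ Gz Gw; rewrite /= mulrzBr.
Qed.

(** The multiples of [b] in the domain of [G] are those of [b *~ n], so agreement at [b *~ n]
    propagates by taking powers. *)
Lemma character_graph_compat G b t (n : nat) : character_graph G ->
  (forall m : int, (exists z, G (b *~ m, z)) <-> (n %| m)%Z) ->
  G (b *~ n, t ^+ n) -> forall (m : int) z, G (b *~ m, z) -> z = t ^ m.
Proof.
move=> GG nP Gn m z Gz; have [k mE] : exists k : int, m = k * n.
  by apply/dvdzP/nP; exists z.
have := character_graphX k GG Gn; rewrite /= -mulrzA mulrC -mE => Gm.
by rewrite (character_graph_fun GG Gz Gm) mE mulrC -exprz_exp.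
Qed.

Lemma character_graph_extend G b : character_graph G ->
  exists t, character_graph (adjoin G b t).
Proof.
move=> GG; have [n nP] := domain_period b GG.
have [s Gs] : exists s, G (b *~ n, s) by apply/nP; exact: dvdzz.
(* If [n = 0], no nonzero multiple of [b] constrains [t], and 1 will do; otherwise divisibility of
   the circle provides an [n]-th root. *)
have [t t1 tn] : exists2 t, `|t| = 1 & t ^+ n = s.
  have [n0|n_gt0] := posnP n.
    exists 1; rewrite ?normr1 // n0 expr0.
    by case: GG => _ _ G1 _; rewrite (G1 s) // -(mulr0z b) -[0]/(Posz 0) -n0.
  exists (n.-root s); last exact: rootCK.
  apply: (@norm1_of_expr _ n) => //; rewrite rootCK //.
  by case: GG => _ _ _ /(_ _ Gs).
exists t; apply: character_graph_adjoin => //.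
by apply: (character_graph_compat GG nP); rewrite tn.
Qed.

(** For [n = 0] take -1; for [n] at least 2, a root of the sum of the powers of [t] below [n], which
    at 1 has the nonzero value [n]. *)
Lemma nontrivial_unity_root n : n != 1%N ->
  exists t : C, [/\ `|t| = 1, t ^+ n = 1 & t != 1].
Proof.
case: n => [_|[//|n _]].
  by exists (-1); rewrite normrN1 expr0 -subr_eq0 -opprD oppr_eq0 -mulr2n pnatr_eq0.
have /closed_rootP[t] : size (\poly_(i < n.+2) (1 : C)) != 1%N.
  by rewrite size_poly_eq // oner_eq0.
rewrite /root horner_poly => /eqP t_root.
have sum0 : \sum_(i < n.+2) t ^+ i = 0.
  by rewrite -[RHS]t_root; apply: eq_bigr => i _; rewrite mul1r.
have tn : t ^+ n.+2 = 1 by apply/eqP; rewrite -subr_eq0 subrX1 sum0 mulr0.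
exists t; split=> //; first by apply: (@norm1_of_expr _ n.+2); rewrite ?tn ?normr1.
apply/eqP => t1; move: sum0; rewrite t1.
under eq_bigr do rewrite expr1n.
by rewrite sumr_const card_ord => /eqP; rewrite pnatr_eq0.
Qed.

Lemma maximal_character_graph G0 : character_graph G0 ->
  exists G, [/\ character_graph G, G0 `<=` G &
    forall G', character_graph G' -> G `<=` G' -> G' `<=` G].
Proof.
move=> G0G.
(* Taking the union with [G0] makes the empty chain admissible in Zorn's lemma. *)
have [F FP Ftot|A [AG Amax]] :=
  @Zorn_bigcup _ [set A | character_graph (A `|` G0)].
  have up p q : (\bigcup_(A in F) A `|` G0) p -> (\bigcup_(A in F) A `|` G0) q ->
      exists A, [/\ character_graph (A `|` G0),
        A `|` G0 `<=` \bigcup_(A in F) A `|` G0, (A `|` G0) p & (A `|` G0) q].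
    have FA A : F A -> A `|` G0 `<=` \bigcup_(A in F) A `|` G0.
      by move=> FA; apply: setSU; exact: bigcup_sup.
    move=> [[A AF Ap]|Gp] [[B BF Bq]|Gq].
    - have [AB|BA] := Ftot _ _ AF BF.
        exists B; split; [exact: FP|exact: FA|by left; exact: AB|by left].
      exists A; split; [exact: FP|exact: FA|by left|by left; exact: BA].
    - exists A; split; [exact: FP|exact: FA|by left|by right].
    - exists B; split; [exact: FP|exact: FA|by right|by left].
    - exists set0; rewrite set0U; split=> //.
  split.
  - by right; case: G0G.
  - move=> p q Up Uq; have [A [[_ AB _ _] sA Ap Aq]] := up p q Up Uq.
    by apply: sA; exact: AB.
  - by move=> z Uz; have [A [[_ _ A1 _] _ Az _]] := up _ _ Uz Uz; exact: A1.
  - by move=> p Up; have [A [[_ _ _ An] _ Ap _]] := up _ _ Up Up; exact: An.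
exists (A `|` G0); split; [exact: AG|by move=> p; right|].
move=> G' G'G; rewrite subUset => -[AG' G0G'].
apply: contrapT => G'A; apply: (Amax G').
  by split=> // G'sA; apply: G'A => p /G'sA; left.
by rewrite /= (setUidl G0G').
Qed.

(** Start from the trivial character of [H], give [a] a value other than 1 compatible with its order
    modulo [H], then extend maximally. *)
Lemma separating_character H a : zmod_closed (mem H) -> ~ H a ->
  exists chi : X -> C, [/\ forall x, `|chi x| = 1,
    {morph chi : x y / x + y >-> x * y},
    forall x, H x -> chi x = 1 & chi a != 1].
Proof.
move=> /zmod_closedP[H0 HB] nHa.
pose G0 : set (X * C) := [set p | H p.1 /\ p.2 = 1].
have G0G : character_graph G0.
  split=> //=.
  - by move=> p q [Hp ->] [Hq ->]; rewrite divr1; split=> //; exact: HB.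
  - by move=> z [].
  - by move=> p [_ ->]; rewrite normr1.
have [n nP] := domain_period a G0G.
have n1 : n != 1%N.
  apply/eqP => n1; apply: nHa.
  have /nP[z []] : (n %| 1)%Z by rewrite n1.
  by rewrite mulr1z.
have [t [t1 tn tN1]] := nontrivial_unity_root n1.
have Ga : character_graph (adjoin G0 a t).
  apply: character_graph_adjoin => //; apply: (character_graph_compat G0G nP).
  by rewrite tn; have /nP[z [Hz _]] := dvdzz n.
have [G [GG G0sG Gmax]] := maximal_character_graph Ga.
(* A maximal graph is total, since any [x] could otherwise be adjoined. *)
have Gdom x : exists z, G (x, z).
  have [s Gs] := character_graph_extend x GG; exists s.
  by apply: (Gmax _ Gs); [exact: sub_adjoin|exact: adjoin_mem].
have [chi chiP] := choice Gdom.
exists chi; split.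
- by move=> x; case: GG => _ _ _ /(_ _ (chiP x)).
- move=> x y; apply: (character_graph_fun GG (chiP _)).
  exact: (character_graphM GG (chiP x) (chiP y)).
- move=> x Hx; apply: (character_graph_fun GG (chiP _)).
  by apply/G0sG/sub_adjoin.
- suff -> : chi a = t by [].
  by apply: (character_graph_fun GG (chiP _)); apply/G0sG/adjoin_mem.
Qed.

End CharacterExtension.

(** * Subgroups generated by neighborhoods of zero *)

Section GeneratedSubgroup.
Implicit Types (X : topologicalZmodType).

Lemma generated_subgroup_zmod_closed (X : zmodType) (V : set X) :
  zmod_closed (mem (generated_subgroup V)).
Proof.
apply/zmod_closedP; split=> [|x y xV yV] H [HP VH].
  by case/zmod_closedP: (HP).
by case/zmod_closedP: (HP) => _; apply; [exact: xV|exact: yV].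
Qed.

Lemma near_subr X (V : set X) x : nbhs (0 : X) V -> \forall y \near x, V (y - x).
Proof.
move=> V0; have cx : y - x @[y --> x] --> x - x.
  apply: (@continuous2_cvg _ _ _ _ _ _ _ _ (fun y z => y - z)).
  - exact: (@sub_continuous X (x, x)).
  - exact: cvg_id.
  - exact: cvg_cst.
by apply: cx; rewrite subrr.
Qed.

(** Near any [x], the points [y] have [y - x] in [H], so membership in [H] is locally constant. *)
Lemma subgroup_clopen X (H : set X) :
  zmod_closed (mem H) -> nbhs (0 : X) H -> clopen H.
Proof.
move=> /zmod_closedP[H0 HB] nH; split.
  rewrite openE => x Hx; rewrite /interior.
  near=> y; have -> : y = (y - x) - (0 - x) by rewrite sub0r opprK subrK.
  by apply: (HB (y - x)); [near: y; exact: near_subr|exact: HB].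
rewrite -[H]setCK; apply: open_closedC.
rewrite openE => x nHx; rewrite /interior.
near=> y => Hy; apply: nHx; rewrite -[x](subKr y).
by apply: HB => //; near: y; exact: near_subr.
Unshelve. all: by end_near. Qed.

Lemma connected_locally_generated X :
  connected [set: X] -> locally_generated X.
Proof.
move=> cX V V0; have HZ := generated_subgroup_zmod_closed V.
have [oV cV] : clopen (generated_subgroup V).
  apply: subgroup_clopen => //; apply: filterS V0.
  exact: sub_gen_smallest.
apply: cX; [|by exists (generated_subgroup V); rewrite ?setTI..].
by exists 0; case/zmod_closedP: HZ.
Qed.

Lemma locally_generated_sum X (V : set X) (a : X) :
  locally_generated X -> nbhs (0 : X) V ->
  exists s : seq X,
    [/\ (0 < size s)%N, {in s, forall y, V y} & \sum_(y <- s) y = a].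
Proof.
move=> lgX V0; pose W := V `&` -%R @^-1` V.
have W0 : nbhs (0 : X) W.
  apply: filterI => //; apply: (@opp_continuous X).
  by rewrite oppr0.
have WN y : W y -> W (- y) by move=> [Vy VNy]; split; rewrite /preimage /= ?opprK.
pose S : set X :=
  [set a | exists2 s : seq X, {in s, forall y, W y} & \sum_(y <- s) y = a].
have : generated_subgroup W `<=` S.
  apply: smallest_sub; last first.
    move=> y Wy; exists [:: y]; last by rewrite big_seq1.
    by move=> z; rewrite inE => /eqP->.
  apply/zmod_closedP; split; first by exists [::]; rewrite ?big_nil.
  move=> _ _ [s sW <-] [t tW <-]; exists (s ++ map -%R t).
    move=> y; rewrite mem_cat => /orP[/sW //|/mapP[z zt ->]].
    by apply/WN/tW.
  by rewrite big_cat big_map sumrN.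
rewrite lgX // => /(_ a I)[s sW sa].
(* The extra 0 ensures that the sequence is nonempty, as concatenation requires. *)
exists (0 :: s); split=> //; last by rewrite big_cons add0r.
move=> y; rewrite inE => /orP[/eqP->|/sW[]//].
exact: nbhs_singleton.
Qed.

End GeneratedSubgroup.

(** * Infinite concatenation of nonempty finite blocks *)

Section Concatenation.
Variables (T : eqType) (x0 : T) (s : nat -> seq T).
Hypothesis s_gt0 : forall k, (0 < size (s k))%N.

(** Blocks being nonempty, the first [n.+1] of them reach index [n], and the default [x0] is never
    read. *)
Definition concat n : T := nth x0 (flatten (mkseq s n.+1)) n.

Lemma flatten_mkseqD M N : flatten (mkseq s (M + N)) =
  flatten (mkseq s M) ++ flatten [seq s k | k <- iota M N].
Proof. by rewrite /mkseq iotaD map_cat flatten_cat. Qed.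

Lemma leq_size_flatten_mkseq N : (N <= size (flatten (mkseq s N)))%N.
Proof.
elim: N => // N IHN; rewrite -addn1 flatten_mkseqD size_cat /= cats0.
exact: leq_add.
Qed.

Lemma concatE N n : (n < size (flatten (mkseq s N)))%N ->
  concat n = nth x0 (flatten (mkseq s N)) n.
Proof.
have ext M K : (n < size (flatten (mkseq s M)))%N -> (M <= K)%N ->
    nth x0 (flatten (mkseq s K)) n = nth x0 (flatten (mkseq s M)) n.
  by move=> ltn /subnKC <-; rewrite flatten_mkseqD nth_cat ltn.
move=> ltn; have [le|/ltnW le] := leqP n.+1 N; last exact: ext.
by rewrite (ext _ _ _ le) // leq_size_flatten_mkseq.
Qed.

(** This will make the concatenation a null sequence when the blocks lie in shrinking
    neighborhoods. *)
Lemma concat_tail N n : (size (flatten (mkseq s N)) <= n)%N ->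
  exists2 k, (N <= k)%N & concat n \in s k.
Proof.
move=> le_n; have le_Nn : (N <= n.+1)%N.
  exact: leq_trans (leq_size_flatten_mkseq N) (leqW le_n).
have split_n := flatten_mkseqD N (n.+1 - N); rewrite subnKC // in split_n.
have := leq_size_flatten_mkseq n.+1.
rewrite /concat split_n size_cat nth_cat (leq_gtF le_n) => lt_n.
set t := flatten [seq _ | _ <- _] in lt_n *.
have /flattenP[y /mapP[k k_in ->] tk] : nth x0 t (n - size (flatten (mkseq s N))) \in t.
  by rewrite mem_nth // ltn_subLR.
by exists k => //; move: k_in; rewrite mem_iota => /andP[].
Qed.

Lemma prod_concat (A : comPzRingType) (f : T -> A) N :
  \prod_(k < size (flatten (mkseq s N))) f (concat k) =
  \prod_(i < N) \prod_(y <- s i) f y.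
Proof.
transitivity (\prod_(y <- flatten (mkseq s N)) f y).
  rewrite (big_nth x0) big_mkord; apply: eq_bigr => k _.
  by rewrite (concatE (ltn_ord k)).
by rewrite big_flatten big_map -{1}[N]subn0 -/(index_iota 0 N) big_mkord.
Qed.

End Concatenation.

(** * Local generation and the class of groups without nontrivial [Gamma_abs] *)

Section ClassB.
Variables (R : realType) (X : topologicalZmodType).
Local Open Scope complex_scope.

(** Such a [xi] is constant on each translate of [H], hence continuous; along a null sequence its
    partial products become stationary. *)
Lemma Gamma_abs_of_open_kernel (H : set X) (xi : X -> R[i]^o) :
  nbhs (0 : X) H -> (forall x, `|xi x| = 1) ->
  {morph xi : x y / x + y >-> x * y} -> (forall x, H x -> xi x = 1) ->
  Gamma_abs R X xi.
Proof.
move=> nH xi1 xiD xiH; split; first split=> // x.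
  apply: cvg_near_cst; near=> y.
  rewrite -[y](subrK x) xiD xiH ?mul1r //.
  by near: y; exact: near_subr.
move=> x x0; have [N _ NH] := x0 _ nH.
exists (\prod_(k < N) xi (x k)); first by rewrite /circle /= normr_prod big1.
apply: cvg_near_cst; exists N => // n /= Nn.
rewrite -(big_mkord predT (xi \o x)) (@big_cat_nat _ _ _ N) ?leqW //=.
rewrite big_mkord [X in _ * X]big_nat_cond [X in _ * X]big1 ?mulr1 // => k /andP[/andP[Nk _] _].
by apply/xiH/NH.
Unshelve. all: by end_near. Qed.

Lemma class_B_locally_generated : class_B R X -> locally_generated X.
Proof.
move=> BX V V0; have HZ := generated_subgroup_zmod_closed V.
rewrite -subTset => a _; apply: contrapT => nHa.
have [chi [chi1 chiD chiH chia]] := @separating_character R[i] X _ a HZ nHa.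
have : Gamma_abs R X chi.
  apply: Gamma_abs_of_open_kernel chi1 chiD chiH.
  by apply: filterS V0; exact: sub_gen_smallest.
by rewrite BX => chi_cst; move: chia; rewrite chi_cst eqxx.
Qed.

Lemma metrizable_nbhs_basis : metrizable R X ->
  exists U : nat -> set X, (forall k, nbhs (0 : X) (U k)) /\
    forall V, nbhs (0 : X) V -> \forall k \near \oo, U k `<=` V.
Proof.
move=> [d [_ dn]]; exists (fun k => [set y | d 0 y < k.+1%:R^-1]); split.
  by move=> k; rewrite dn; exists k.+1%:R^-1 => //=; rewrite invr_gt0 ltr0n.
move=> V; rewrite dn => -[e /= e0 eV].
near=> k => y /= dy; apply: eV; apply: lt_trans dy _.
near: k; exact: (near_infty_natSinv_lt (PosNum e0)).
Unshelve. all: by end_near. Qed.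

Lemma locally_generated_class_B :
  metrizable R X -> locally_generated X -> class_B R X.
Proof.
move=> /metrizable_nbhs_basis[U [U0 UV]] lgX.
rewrite /class_B eqEsubset; split=> [xi [[xi1 xiD _] xiP]|_ ->]; last first.
  apply: (@Gamma_abs_of_open_kernel setT) => //; first exact: filterT.
    by move=> x; rewrite normr1.
  by move=> x y; rewrite mulr1.
apply/funext => a /=.
have xi0 : xi 0 = 1.
  have xi00 : xi 0 != 0 by rewrite -normr_gt0 xi1.
  by apply: (mulIf xi00); rewrite -xiD addr0 mul1r.
have [s sP] := choice (fun k => locally_generated_sum a lgX (U0 k)).
have s_gt0 k : (0 < size (s k))%N by case: (sP k).
pose x := concat 0 s.
have x0 : c0 X x.
  move=> V /UV[N _ NV]; exists (size (flatten (mkseq s N))) => // n /= Nn.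
  have [k Nk xk] := concat_tail 0 s_gt0 Nn.
  by apply: (NV k Nk); case: (sP k) => _ /(_ _ xk).
have [l l1 xl] := xiP x x0.
have prodE N : \prod_(k < size (flatten (mkseq s N))) xi (x k) = xi a ^+ N.
  rewrite (prod_concat 0 s_gt0 xi) -[N in RHS]card_ord -prodr_const.
  apply: eq_bigr => i _; case: (sP i) => _ _ <-.
  by rewrite (big_morph xi xiD xi0).
have powl : xi a ^+ n.+1 @[n --> \oo] --> l.
  (* The partial product of index [m n] has [(m n).+1] factors, so it ends exactly with block [n]
     and equals [xi a ^+ n.+1]. *)
  pose m n := (size (flatten (mkseq s n.+1))).-1.
  have mE n : (m n).+1 = size (flatten (mkseq s n.+1)).
    by rewrite prednK // (leq_trans _ (leq_size_flatten_mkseq s_gt0 _)).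
  have moo : m n @[n --> \oo] --> \oo.
    move=> A [N _ NA]; exists N => // n /= Nn; apply: NA => /=.
    by rewrite -ltnS mE (leq_trans _ (leq_size_flatten_mkseq s_gt0 _)).
  rewrite (_ : (fun n => _) = (fun n => \prod_(k < (m n).+1) xi (x k))).
    exact: (cvg_comp m _ moo xl).
  by apply/funext => n; rewrite mE prodE.
(* Shifting the sequence of powers by one keeps its limit, while continuity of multiplication gives
   the limit [xi a * l]. *)
have powl' : xi a * xi a ^+ n.+1 @[n --> \oo] --> l.
  rewrite (_ : (fun n => _) = (fun n => xi a ^+ n.+2)).
    by rewrite (cvg_shiftS (fun n => xi a ^+ n.+1 : R[i]^o)).
  by apply/funext => n; rewrite [in RHS]exprS.
have /esym xal : l = xi a * l.
  apply: (cvg_unique (@norm_hausdorff _ R[i]^o) powl').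
  exact: (@cvgMl_tmp R[i] _ _ _ _ (xi a) _ powl).
have l0 : l != 0 by rewrite -normr_gt0 l1.
by apply: (mulIf l0); rewrite xal mul1r.
Qed.

End ClassB.

Theorem corollary6p13 (R : realType) (X : topologicalZmodType)
    (X_metrizable : metrizable R X) :
  (class_B R X <-> locally_generated X) /\
  (connected [set: X] -> class_B R X).
Proof.
have lgB := @locally_generated_class_B R X X_metrizable.
split; last by move=> /connected_locally_generated.
by split=> //; exact: class_B_locally_generated.
Qed.
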